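(* Let $\mathbf{A}\in\mathbb{R}^{d\times d}$ be invertible, $\mathbf{b}\in\mathbb{R}^d$, and let a valid two-layer region graph with edge set $\mathcal{E}_{\mathcal{R}}$ be given for $\mathbf{A}$. Let $\mathbf{m}^{(n)}_e,\mathbf{\Lambda}^{(n)}_e$ ($e\in\mathcal{E}_{\mathcal{R}}$) be the messages after the $n$-th sweep of the generalized two-layer GaBP algorithm (defined in the context; all inverses occurring in it exist). If there is $N\in\mathbb{N}$ such that $\mathbf{m}^{(N+k)}_{e}=\mathbf{m}^{(N)}_{e}$ and $\mathbf{\Lambda}^{(N+k)}_{e}=\mathbf{\Lambda}^{(N)}_{e}$ for all $e\in\mathcal{E}_{\mathcal{R}}$ and all $k\in\mathbb{N}$, then, for these steady-state messages, for each large region $L$ one has $[\mathbf{x}]_{L}\equiv\widetilde{\mathbf{\Lambda}}_0^{-1}\widetilde{\mathbf{b}}_0=\left[\mathbf{A}^{-1}\mathbf{b}\right]_{L}$, where $\widetilde{\mathbf{\Lambda}}_0,\widetilde{\mathbf{b}}_0$ are the quantities computed by the algorithm for $L$.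
   Context: $\mathbf{A}$ is not assumed symmetric. Let $\Gamma$ be the undirected graph on $\{1,\dots,d\}$ with an edge $\{i,j\}$, $i\ne j$, whenever $A_{ij}\ne 0$ or $A_{ji}\neq0$. A region is a connected subgraph of $\Gamma$, consisting of a nonempty set of vertices and all edges of $\Gamma$ between them; it is identified with its vertex set. A two-layer region graph is a directed bipartite graph whose vertices $\mathcal{R}$ are finitely many large regions $\{L_i\}$ and small regions $\{l_i\}$, with edges $(L,l)\in\mathcal{E}_{\mathcal{R}}$ directed from some large regions $L$ to small regions $l\subset L$. If $(L,l)\in\mathcal{E}_{\mathcal{R}}$ then $L$ is a parent of $l$ and $l$ a child of $L$; $P(l)$ is the set of parents of $l$, $C(L)$ the set of children of $L$. Counting numbers are $c_L=1$ for large regions and $c_l=1-|P(l)|$ for small regions. The region graph is valid if every vertex $v$ and every edge $e$ of $\Gamma$ is counted exactly once: $\sum_{r\in\mathcal{R},\,v\in r}c_r=\sum_{r\in\mathcal{R},\,e\in r}c_r=1$. It is also assumed that the nonempty sets among the small regions $l_i$ and the sets $L_j\setminus\bigcup_{l\in C(L_j)}l$ form a partition of $\{1,\dots,d\}$. Notation: for a set of indices $k$, $[\mathbf{M}]_k$ is the submatrix of $\mathbf{M}$ with rows and columns in $k$, and $[\mathbf{v}]_k$ the subvector of $\mathbf{v}$ with indices in $k$. For $k\subset L$ and a matrix $\mathbf{C}$ (vector $\mathbf{c}$) indexed by $k$, $]\mathbf{C}[_k$ ($]\mathbf{c}[_k$) is its extension by zeros to a matrix (vector) indexed by $L$. Generalized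 two-layer GaBP algorithm. Each edge $(L,l)\in\mathcal{E}_{\mathcal{R}}$ carries messages $\mathbf{m}_{Ll}\in\mathbb{R}^{|l|}$ and $\mathbf{\Lambda}_{Ll}\in\mathbb{R}^{|l|\times|l|}$. Repeat sweeps; in each sweep, for each large region $L$ in a fixed order, using current message values (in-place updates): 1. $\widetilde{\mathbf{b}}_0=[\mathbf{b}]_L+\sum_{l\in C(L)}\sum_{L'\in P(l)\setminus\{L\}}]\mathbf{m}_{L'l}[_l$ and $\widetilde{\mathbf{\Lambda}}_0=[\mathbf{A}]_L+\sum_{l\in C(L)}\sum_{L'\in P(l)\setminus\{L\}}]\mathbf{\Lambda}_{L'l}[_l$; 2. $[\mathbf{x}]_L\leftarrow\widetilde{\mathbf{\Lambda}}_0^{-1}\widetilde{\mathbf{b}}_0$; 3. for each $l\in C(L)$: $\mathbf{m}_{Ll}\leftarrow\big([\widetilde{\mathbf{\Lambda}}_0^{-1}]_l\big)^{-1}[\mathbf{x}]_l-[\mathbf{b}]_l-\sum_{L'\in P(l)\setminus\{L\}}\mathbf{m}_{L'l}$ and $\mathbf{\Lambda}_{Ll}\leftarrow\big([\widetilde{\mathbf{\Lambda}}_0^{-1}]_l\big)^{-1}-[\mathbf{A}]_l-\sum_{L'\in P(l)\setminus\{L\}}\mathbf{\Lambda}_{L'l}$, where in step 3 $[\mathbf{x}]_l$ is the restriction to $l$ of the vector $[\mathbf{x}]_L$ just computed for $L$. *)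

(* Defs.v *)
From HB Require Import structures.
From mathcomp Require Import all_boot all_order all_algebra.
From mathcomp Require Import reals.

Set Implicit Arguments.
Unset Strict Implicit.
Unset Printing Implicit Defensive.

Import Order.TTheory GRing.Theory Num.Theory.
Local Open Scope ring_scope.

Section RegionGraphs.
Variables (R : realType) (d : nat).
Implicit Types (A : 'M[R]_d) (S L l : {set 'I_d}).

Definition graph_of A : rel 'I_d :=
  [rel i j | (i != j) && ((A i j != 0) || (A j i != 0))].

(* A region is the subgraph of [graph_of A] induced by S; it is represented by
   its vertex set S, so an edge {i, j} lies in it iff i and j both lie in S. *)
Definition is_region A S : Prop :=
  S != set0 /\
  forall i j, i \in S -> j \in S ->
    connect [rel u v | [&& u \in S, v \in S & graph_of A u v]] i j.

(* Large and small regions are the two sides of a bipartite graph: a vertex set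
   occurring in both [large] and [small] gives two distinct nodes. *)
Record regionGraph := RegionGraph {
  large : {set {set 'I_d}};
  small : {set {set 'I_d}};
  edges : {set {set 'I_d} * {set 'I_d}} }.

Implicit Types rg : regionGraph.

Definition parents rg l := [set L | (L, l) \in edges rg].
Definition children rg L := [set l | (L, l) \in edges rg].

Definition is_two_layer A rg : Prop :=
  [/\ forall L, L \in large rg -> is_region A L,
      forall l, l \in small rg -> is_region A l
    & forall L l, (L, l) \in edges rg ->
        [/\ L \in large rg, l \in small rg & l \subset L]].

Definition count_large (L : {set 'I_d}) : int := 1.
Definition count_small rg l : int := 1 - #|parents rg l|%:Z.

Definition total_count rg (p : pred {set 'I_d}) : int :=
  \sum_(L in large rg | p L) count_large L
  + \sum_(l in small rg | p l) count_small rg l.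

Definition is_valid A rg : Prop :=
  (forall v, total_count rg (fun r => v \in r) = 1) /\
  (forall i j, graph_of A i j ->
     total_count rg (fun r => (i \in r) && (j \in r)) = 1).

Definition is_partitioning rg : bool :=
  partition
    ((small rg :|: [set L :\: cover (children rg L) | L in large rg]) :\ set0)
    [set: 'I_d].

End RegionGraphs.

Section Indexing.
Variables (R : realType) (d : nat).
Implicit Types k l L : {set 'I_d}.

(* A matrix indexed by k is a matrix of size #|k|, its i-th row and column
   being those of the i-th element [enum_val i] of k. *)
Definition submat k (M : 'M[R]_d) : 'M[R]_#|k| :=
  mxsub (@enum_val _ (mem k)) (@enum_val _ (mem k)) M.
Definition subvec k (v : 'cV[R]_d) : 'cV[R]_#|k| :=
  rowsub (@enum_val _ (mem k)) v.

Definition rank_of k (u : 'I_d) : option 'I_#|k| :=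
  [pick i : 'I_#|k| | @enum_val _ (mem k) i == u].

Definition zextmat k (C : 'M[R]_#|k|) : 'M[R]_d :=
  \matrix_(u, v) match rank_of k u, rank_of k v with
                 | Some i, Some j => C i j
                 | _, _ => 0
                 end.
Definition zextvec k (c : 'cV[R]_#|k|) : 'cV[R]_d :=
  \col_u (if rank_of k u is Some i then c i 0 else 0).

(* Passing through the zero extension to the whole index set 'I_d, the same
   formula gives, for l \subset L, the extension by zeros from l to L and the
   restriction from L to l. *)
Definition extmat l L (C : 'M[R]_#|l|) : 'M[R]_#|L| := submat L (zextmat C).
Definition extvec l L (c : 'cV[R]_#|l|) : 'cV[R]_#|L| := subvec L (zextvec c).
Definition resmat L l (C : 'M[R]_#|L|) : 'M[R]_#|l| := submat l (zextmat C).
Definition resvec L l (c : 'cV[R]_#|L|) : 'cV[R]_#|l| := subvec l (zextvec c).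

End Indexing.

Section Algorithm.
Variables (R : realType) (d : nat).
Variables (A : 'M[R]_d) (b : 'cV[R]_d) (rg : regionGraph d).

(* Only the values at pairs (L, l) that are edges are ever used. *)
Record messages := Messages {
  msg_m : {set 'I_d} -> forall l : {set 'I_d}, 'cV[R]_#|l|;
  msg_Lambda : {set 'I_d} -> forall l : {set 'I_d}, 'M[R]_#|l| }.

Implicit Types (st : messages) (L l : {set 'I_d}).

Definition b0 st L : 'cV[R]_#|L| :=
  subvec L b + \sum_(l in children rg L) \sum_(L' in parents rg l :\ L)
                 extvec L (msg_m st L' l).

Definition Lambda0 st L : 'M[R]_#|L| :=
  submat L A + \sum_(l in children rg L) \sum_(L' in parents rg l :\ L)
                 extmat L (msg_Lambda st L' l).

Definition x_of st L : 'cV[R]_#|L| := invmx (Lambda0 st L) *m b0 st L.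

Definition new_m st L l : 'cV[R]_#|l| :=
  invmx (resmat l (invmx (Lambda0 st L))) *m resvec l (x_of st L)
  - subvec l b - \sum_(L' in parents rg l :\ L) msg_m st L' l.

Definition new_Lambda st L l : 'M[R]_#|l| :=
  invmx (resmat l (invmx (Lambda0 st L)))
  - submat l A - \sum_(L' in parents rg l :\ L) msg_Lambda st L' l.

(* The new messages of L do not depend on the old messages sent by L, so the
   children of L can be treated simultaneously. *)
Definition update st L : messages :=
  Messages
    (fun L' l => if (L' == L) && (l \in children rg L) then new_m st L l
                 else msg_m st L' l)
    (fun L' l => if (L' == L) && (l \in children rg L) then new_Lambda st L l
                 else msg_Lambda st L' l).

Variables (order : seq {set 'I_d}) (init : messages).

Definition sweep st : messages := foldl update st order.

Definition after_sweep (n : nat) : messages := iter n sweep init.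

(* The current (in-place updated) messages at the moment when L is processed
   during sweep number n.+1. *)
Definition current (n : nat) L : messages :=
  foldl update (after_sweep n) (take (index L order) order).

(* [invmx] is total, so the existence of the inverses is a separate condition. *)
Definition inverses_exist : Prop :=
  forall n L, L \in large rg ->
    Lambda0 (current n L) L \in unitmx /\
    forall l, l \in children rg L ->
      resmat l (invmx (Lambda0 (current n L) L)) \in unitmx.

End Algorithm.

(* Main.v *)
Require Import Defs.
From mathcomp Require Import all_boot all_order all_algebra.
From mathcomp Require Import reals.

Set Implicit Arguments.
Unset Strict Implicit.
Unset Printing Implicit Defensive.

Import Order.TTheory GRing.Theory Num.Theory.
Local Open Scope ring_scope.

(** Write E_k for the zero extension from an index set k to all of 'I_d, and
attach to each small region l the total matrix T_l = [A]_l + sum of all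
Lambda_{L'l} over the parents L' of l, and likewise the total vector t_l.

The proof has three ingredients.

- Bookkeeping ([Lambda_decomposition], [b_decomposition]).  For arbitrary
  messages,
    A = sum_L E_L(Lambda0_L) + sum_l c_l E_l(T_l),
    b = sum_L E_L(b0_L)      + sum_l c_l E_l(t_l).
  The parts coming from A and b add up correctly because the counting numbers
  count every vertex and every edge once, and the messages cancel: a message to
  l is seen by the |P(l)| - 1 other parents of l, against c_l = 1 - |P(l)|.

- Consistency ([resvec_agree]).  At a fixed point of the update rule, step 3
  says T_l = ([Lambda0_L^-1]_l)^-1 and t_l = T_l [x_L]_l for every parent L
  of l.  Thus [x_L]_l = T_l^-1 t_l is the same for all parents.  By vertex
  counting, distinct large regions that share a vertex v are parents of the one
  small region containing v ([large_is_parent], [large_unique]), so the local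
  solutions x_L glue to one vector x ([glued], [glued_large]).

- Applying the decomposition of A to x and using Lambda0_L x_L = b0_L and
  T_l [x]_l = t_l turns it, term by term, into that of b, so A x = b
  ([glued_solves]) and x = A^-1 b.

Small regions without parents need care, since no message equation holds for
them.  Edge counting shows that no edge of the graph leaves such a region
([orphan_isolated]), and no large region meets it; there x is taken to be
A^-1 b from the start.

It remains to see that steady sweeps give such a fixed point although updates
are made in place: when L is processed, every message has either its value
from before the sweep or the one it has after it ([current_messages]), and in
the steady state these two agree. *)

(** * Extension by zeros and restriction as matrix products *)
Section Selection.
Variables (R : realType) (d : nat).
Implicit Types (k l L : {set 'I_d}) (M : 'M[R]_d) (v : 'cV[R]_d).

(** The columns are the unit vectors of the elements of k, so extension by zeros
is left multiplication by this matrix and restriction is left multiplication by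
its transpose. *)
Definition selmx k : 'M[R]_(d, #|k|) :=
  \matrix_(u, i) (@enum_val _ (mem k) i == u)%:R.

Lemma trmul_selmx k m (M : 'M[R]_(d, m)) i j :
  ((selmx k)^T *m M) i j = M (@enum_val _ (mem k) i) j.
Proof.
rewrite !mxE (bigD1 (enum_val i)) //= !mxE eqxx mul1r big1 ?addr0 // => u.
by rewrite !mxE eq_sym => /negPf ->; rewrite mul0r.
Qed.

Lemma mul_selmx k m (C : 'M[R]_(#|k|, m)) u j :
  (selmx k *m C) u j = if rank_of k u is Some i then C i j else 0.
Proof.
rewrite !mxE /rank_of; case: pickP => [i /eqP <-|no_i].
  rewrite (bigD1 i) //= !mxE eqxx mul1r big1 ?addr0 // => i' ne_i'.
  by rewrite !mxE (inj_eq enum_val_inj) (negPf ne_i') mul0r.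
by rewrite big1 // => i _; rewrite !mxE no_i mul0r.
Qed.

Lemma mulmx_selmx k m (M : 'M[R]_(m, d)) i j :
  (M *m selmx k) i j = M i (@enum_val _ (mem k) j).
Proof.
rewrite !mxE (bigD1 (enum_val j)) //= !mxE eqxx mulr1 big1 ?addr0 // => u.
by rewrite !mxE eq_sym => /negPf ->; rewrite mulr0.
Qed.

Lemma mulmx_tr_selmx k m (C : 'M[R]_(m, #|k|)) i u :
  (C *m (selmx k)^T) i u = if rank_of k u is Some j then C i j else 0.
Proof.
rewrite !mxE /rank_of; case: pickP => [j /eqP <-|no_j].
  rewrite (bigD1 j) //= !mxE eqxx mulr1 big1 ?addr0 // => j' ne_j'.
  by rewrite !mxE (inj_eq enum_val_inj) (negPf ne_j') mulr0.
by rewrite big1 // => j _; rewrite !mxE no_j mulr0.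
Qed.

Lemma subvecE k v : subvec k v = (selmx k)^T *m v.
Proof. by apply/matrixP => i j; rewrite trmul_selmx !mxE. Qed.

Lemma submatE k M : submat k M = (selmx k)^T *m M *m selmx k.
Proof.
by apply/matrixP => i j; rewrite mulmx_selmx trmul_selmx mxE.
Qed.

Lemma zextvecE k (c : 'cV[R]_#|k|) : zextvec c = selmx k *m c.
Proof. by apply/colP => u; rewrite mul_selmx mxE. Qed.

Lemma zextmatE k (C : 'M[R]_#|k|) : zextmat C = selmx k *m C *m (selmx k)^T.
Proof.
apply/matrixP => u v; rewrite mulmx_tr_selmx mxE.
by case: (rank_of k v) => [j|]; rewrite ?mul_selmx; case: (rank_of k u).
Qed.

Lemma tr_selmxK k : (selmx k)^T *m selmx k = 1%:M.
Proof.
apply/matrixP => i j; rewrite trmul_selmx !mxE (inj_eq enum_val_inj).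
by rewrite eq_sym.
Qed.

Lemma rank_of_notin k u : u \notin k -> rank_of k u = None.
Proof.
rewrite /rank_of; case: pickP => // i /eqP <-.
by rewrite (enum_valP i).
Qed.

(** The product [selmx k *m (selmx k)^T] is the diagonal projection onto the
coordinates in k. *)
Lemma mul_selmx_tr k m (M : 'M[R]_(d, m)) u j :
  (selmx k *m ((selmx k)^T *m M)) u j = if u \in k then M u j else 0.
Proof.
rewrite mul_selmx; have [uk|/rank_of_notin ->//] := boolP (u \in k).
rewrite /rank_of; case: pickP => [i /eqP <-|/(_ (enum_rank_in uk u))].
  by rewrite trmul_selmx.
by rewrite enum_rankK_in ?eqxx.
Qed.

Lemma mulmx_selmx_tr k m (M : 'M[R]_(m, d)) i u :
  (M *m selmx k *m (selmx k)^T) i u = if u \in k then M i u else 0.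
Proof.
rewrite mulmx_tr_selmx; have [uk|/rank_of_notin ->//] := boolP (u \in k).
rewrite /rank_of; case: pickP => [j /eqP <-|/(_ (enum_rank_in uk u))].
  by rewrite mulmx_selmx.
by rewrite enum_rankK_in ?eqxx.
Qed.

Lemma tr_selmx_sub l L : l \subset L ->
  (selmx l)^T *m selmx L *m (selmx L)^T = (selmx l)^T.
Proof.
move=> /subsetP lL; apply/matrixP => i u; rewrite mulmx_selmx_tr.
case: ifPn => // uL; rewrite !mxE; case: eqP => // ui.
by case/negP: uL; apply: lL; rewrite -ui (enum_valP i).
Qed.

Lemma selmx_sub l L : l \subset L ->
  selmx L *m ((selmx L)^T *m selmx l) = selmx l.
Proof.
move=> /subsetP lL; apply/matrixP => u i; rewrite mul_selmx_tr.
case: ifPn => // uL; rewrite mxE; case: eqP => // ui.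
by case/negP: uL; apply: lL; rewrite -ui (enum_valP i).
Qed.

Lemma zext_subvec k v u :
  zextvec (subvec k v) u 0 = if u \in k then v u 0 else 0.
Proof. by rewrite zextvecE subvecE mul_selmx_tr. Qed.

Lemma zext_submat k M u w :
  zextmat (submat k M) u w = if (u \in k) && (w \in k) then M u w else 0.
Proof.
rewrite zextmatE submatE !mulmxA mulmx_selmx_tr.
by rewrite -mulmxA mul_selmx_tr; case: (u \in k); case: (w \in k).
Qed.

Lemma sub_zextvec k (c : 'cV[R]_#|k|) : subvec k (zextvec c) = c.
Proof. by rewrite zextvecE subvecE mulmxA tr_selmxK mul1mx. Qed.

Lemma zextmat_mul k (C : 'M[R]_#|k|) v :
  zextmat C *m v = zextvec (C *m subvec k v).
Proof. by rewrite zextmatE zextvecE subvecE !mulmxA. Qed.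

Lemma zext_extvec l L (c : 'cV[R]_#|l|) : l \subset L ->
  zextvec (extvec L c) = zextvec c.
Proof.
by move=> lL; rewrite /extvec !zextvecE subvecE !mulmxA -(mulmxA (selmx L)) selmx_sub.
Qed.

Lemma zext_extmat l L (C : 'M[R]_#|l|) : l \subset L ->
  zextmat (extmat L C) = zextmat C.
Proof.
move=> lL; rewrite /extmat !zextmatE submatE !mulmxA -(mulmxA (selmx L)).
by rewrite selmx_sub // -!mulmxA (mulmxA (selmx l)^T) tr_selmx_sub.
Qed.

Lemma resvec_sub L l v : l \subset L -> resvec l (subvec L v) = subvec l v.
Proof.
move=> /subsetP lL; apply/colP => i; rewrite [LHS]mxE [RHS]mxE.
by rewrite zext_subvec lL //; apply: enum_valP.
Qed.

Lemma resvecE L l (c : 'cV[R]_#|L|) i :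
  resvec l c i 0 = zextvec c (@enum_val _ (mem l) i) 0.
Proof. exact: mxE. Qed.

Lemma zextvecD k (c c' : 'cV[R]_#|k|) : zextvec (c + c') = zextvec c + zextvec c'.
Proof. by rewrite !zextvecE mulmxDr. Qed.

Lemma zextmatD k (C C' : 'M[R]_#|k|) : zextmat (C + C') = zextmat C + zextmat C'.
Proof. by rewrite !zextmatE mulmxDr mulmxDl. Qed.

Lemma zextvec_sum k (I : Type) (r : seq I) (P : pred I) (F : I -> 'cV[R]_#|k|) :
  zextvec (\sum_(i <- r | P i) F i) = \sum_(i <- r | P i) zextvec (F i).
Proof.
by rewrite zextvecE mulmx_sumr; apply: eq_bigr => i _; rewrite zextvecE.
Qed.

Lemma zextmat_sum k (I : Type) (r : seq I) (P : pred I) (F : I -> 'M[R]_#|k|) :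
  zextmat (\sum_(i <- r | P i) F i) = \sum_(i <- r | P i) zextmat (F i).
Proof.
rewrite zextmatE mulmx_sumr mulmx_suml.
by apply: eq_bigr => i _; rewrite zextmatE.
Qed.

End Selection.

(** * Counting numbers *)
Section Counting.
Variables (R : realType) (d : nat) (A : 'M[R]_d) (rg : regionGraph d).
Hypothesis rg_two_layer : is_two_layer A rg.
Hypothesis rg_valid : is_valid A rg.

Lemma edge_of_parent (L l : {set 'I_d}) : L \in parents rg l ->
  [/\ L \in large rg, l \in small rg & l \subset L].
Proof. by rewrite inE => /(let: And3 _ _ h := rg_two_layer in h _ _). Qed.

(** Exchanging the sums, F L' l occurs once for each parent of l other than L',
that is |P(l)| - 1 times, which is the opposite of the counting number of l. *)
Lemma messages_cancel (V : zmodType) (F : {set 'I_d} -> {set 'I_d} -> V) :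
  \sum_(L in large rg) \sum_(l in children rg L)
      \sum_(L' in parents rg l :\ L) F L' l
  + \sum_(l in small rg)
      (\sum_(L' in parents rg l) F L' l) *~ count_small rg l = 0.
Proof.
rewrite (exchange_big_dep (mem (small rg))) /=; last first.
  move=> L l _; rewrite inE => Ll.
  by have [|] := @edge_of_parent L l; rewrite ?inE.
rewrite -big_split big1 //= => l l_small.
under eq_bigl => L.
  rewrite (_ : _ && _ = (L \in parents rg l)); last first.
    rewrite !inE andb_idl // => Ll.
    by have [|] := @edge_of_parent L l; rewrite ?inE.
over.
have -> : \sum_(L in parents rg l) \sum_(L' in parents rg l :\ L) F L' l
   = \sum_(L in parents rg l) (\sum_(L' in parents rg l) F L' l - F L l).
  by apply: eq_bigr => L Ll; rewrite (big_setD1 L Ll) /= [RHS]addrC addKr.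
rewrite sumrB sumr_const /count_small mulrzBr mulr1z -pmulrn.
by rewrite addrA subrK subrr.
Qed.

Lemma count_weight (V : zmodType) (p : pred {set 'I_d}) (a : V) :
  \sum_(L in large rg) (if p L then a else 0)
  + \sum_(l in small rg) (if p l then a else 0) *~ count_small rg l
  = a *~ total_count rg p.
Proof.
rewrite /total_count mulrzDr !mulrz_sumr !big_mkcondr /=; congr (_ + _).
apply: eq_bigr => l _; case: ifP => //; by rewrite mul0rz.
Qed.

Lemma mxMz m n (M : 'M[R]_(m, n)) (c : int) i j : (M *~ c) i j = M i j *~ c.
Proof. by rewrite -scaler_int mxE mulrzl. Qed.

Lemma count_vec (b : 'cV[R]_d) :
  \sum_(L in large rg) zextvec (subvec L b)
  + \sum_(l in small rg) zextvec (subvec l b) *~ count_small rg l = b.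
Proof.
apply/colP => u; rewrite mxE !summxE.
have [/(_ u) cu _] := rg_valid.
rewrite -[RHS]mulr1z -cu -count_weight; congr (_ + _); apply: eq_bigr => l _.
  exact: zext_subvec.
by rewrite mxMz zext_subvec.
Qed.

(** An entry of A off the diagonal is either zero or belongs to an edge, so the
validity conditions cover all the entries that matter. *)
Lemma count_mat :
  \sum_(L in large rg) zextmat (submat L A)
  + \sum_(l in small rg) zextmat (submat l A) *~ count_small rg l = A.
Proof.
apply/matrixP => u w; rewrite mxE !summxE.
pose p (S : {set 'I_d}) := (u \in S) && (w \in S).
transitivity (A u w *~ total_count rg p).
  rewrite -count_weight; congr (_ + _); apply: eq_bigr => l _.
    exact: zext_submat.
  by rewrite mxMz zext_submat.
have [cv ce] := rg_valid.
have [->|A_uw] := eqVneq (A u w) 0; first by rewrite mul0rz.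
suff -> : total_count rg p = 1 by rewrite mulr1z.
rewrite /p; have [<-|ne_uw] := eqVneq u w.
  rewrite -(cv u) /total_count; congr (_ + _); apply: eq_bigl => S;
  by rewrite andbb.
by rewrite ce // /graph_of /= ne_uw A_uw.
Qed.

Hypothesis rg_partition : is_partitioning rg.

Lemma small_disjoint (l l' : {set 'I_d}) v : l \in small rg -> l' \in small rg ->
  v \in l -> v \in l' -> l = l'.
Proof.
move=> sl sl' vl vl'; apply/eqP; apply/negP => /negP ne_ll'.
case/and3P: rg_partition => _ /trivIsetP triv _.
have nz (S : {set 'I_d}) : v \in S -> S != set0.
  by move=> vS; apply/set0Pn; exists v.
have := triv l l'; rewrite !inE sl sl' (nz l) // (nz l') //.
move=> /(_ isT isT ne_ll').
by move/disjointFr/(_ vl); rewrite vl'.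
Qed.

Lemma small_sum (V : zmodType) (l : {set 'I_d}) v (F : {set 'I_d} -> V) :
  l \in small rg -> v \in l -> \sum_(l' in small rg | v \in l') F l' = F l.
Proof.
move=> sl vl; rewrite (big_pred1 l) // => l'.
apply/andP/eqP => [[sl' vl']|-> //]; exact: (small_disjoint sl' sl vl' vl).
Qed.

Lemma large_sum (p : pred {set 'I_d}) :
  \sum_(L in large rg | p L) count_large L = #|[set L in large rg | p L]|%:Z.
Proof.
rewrite sumr_const natz.
by congr (Posz _); apply: eq_card => L; rewrite !inE.
Qed.

(** Since l is the only small region containing v, validity at v says that
exactly |P(l)| large regions contain v; the parents of l are among them, hence
they are all of them. *)
Lemma large_is_parent (L l : {set 'I_d}) v : L \in large rg -> l \in small rg ->
  v \in L -> v \in l -> L \in parents rg l.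
Proof.
move=> lL sl vL vl; have [/(_ v) cv _] := rg_valid; move: cv.
rewrite /total_count large_sum (small_sum _ sl vl) /count_small.
move=> cv.
have {cv} card_eq : #|[set L in large rg | v \in L]| = #|parents rg l|.
  (* cv reads n + (1 - |P(l)|) = 1, where n counts the large regions with v. *)
  apply/eqP; rewrite -eqz_nat -subr_eq0; apply/eqP.
  by rewrite -[RHS](subrr 1) -[X in _ = X - _]cv; rewrite addrA addrAC addrK.
have sub : parents rg l \subset [set L in large rg | v \in L].
  apply/subsetP => L' /edge_of_parent[lL' _ /subsetP sub]; rewrite inE lL'.
  exact: sub.
have /eqP -> : parents rg l == [set L in large rg | v \in L].
  by rewrite eqEcard sub card_eq leqnn.
by rewrite inE lL.
Qed.

(** Outside the small regions, only large regions contribute to the count of v,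
each with weight one. *)
Lemma large_unique (L L' : {set 'I_d}) v : L \in large rg -> L' \in large rg ->
  v \in L -> v \in L' -> {in small rg, forall l : {set 'I_d}, v \notin l} -> L = L'.
Proof.
move=> lL lL' vL vL' no_small; have [/(_ v) cv _] := rg_valid; move: cv.
rewrite /total_count large_sum big_pred0 => [|l]; last first.
  by apply/andP => -[/no_small/negP].
rewrite addr0 => -[/eqP/cards1P[L0 eq_L0]].
have in_L0 S : S \in large rg -> v \in S -> S = L0.
  by move=> lS vS; apply/set1P; rewrite -eq_L0 inE lS.
by rewrite (in_L0 L) // (in_L0 L').
Qed.

(** An edge leaving l would not be counted at all: a large region containing it
would be a parent of l, and a small one would meet l, hence be l. *)
Lemma orphan_isolated (l : {set 'I_d}) u v : l \in small rg ->
  parents rg l = set0 -> u \in l -> v \notin l -> A u v = 0.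
Proof.
move=> sl orphan ul vl; apply/eqP; apply/negP => /negP A_uv.
have [_ /(_ u v)] := rg_valid; rewrite /graph_of /= A_uv /= andbT.
have ne_uv : u != v by apply: contraNneq vl => <-.
move=> /(_ ne_uv).
rewrite /total_count !big_pred0 // => S; apply/and3P => -[rS uS vS].
  by case/negP: vl; rewrite (small_disjoint sl rS ul uS).
by have := large_is_parent rS sl uS ul; rewrite orphan inE.
Qed.

End Counting.

(** * Fixed points of the update rule *)
Section FixedPoint.
Variables (R : realType) (d : nat) (A : 'M[R]_d) (b : 'cV[R]_d).
Variables (rg : regionGraph d) (st : messages R d).
Implicit Types (L l : {set 'I_d}).

Definition small_Lambda l : 'M[R]_#|l| :=
  submat l A + \sum_(L in parents rg l) msg_Lambda st L l.
Definition small_b l : 'cV[R]_#|l| :=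
  subvec l b + \sum_(L in parents rg l) msg_m st L l.

Definition steady_state : Prop := forall L l, (L, l) \in edges rg ->
  msg_m st L l = new_m A b rg st L l /\
  msg_Lambda st L l = new_Lambda A rg st L l.

Definition invertible_state : Prop := forall L, L \in large rg ->
  Lambda0 A rg st L \in unitmx /\
  forall l, l \in children rg L ->
    resmat l (invmx (Lambda0 A rg st L)) \in unitmx.

Hypothesis A_unit : A \in unitmx.
Hypothesis rg_two_layer : is_two_layer A rg.
Hypothesis rg_valid : is_valid A rg.
Hypothesis rg_partition : is_partitioning rg.
Hypothesis st_steady : steady_state.
Hypothesis st_inv : invertible_state.

Lemma Lambda_decomposition :
  \sum_(L in large rg) zextmat (Lambda0 A rg st L)
  + \sum_(l in small rg) zextmat (small_Lambda l) *~ count_small rg l = A.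
Proof.
pose F L l := zextmat (msg_Lambda st L l).
rewrite -[RHS](count_mat rg_valid) -[RHS]addr0.
rewrite -[X in _ = _ + X](messages_cancel rg_two_layer F) addrACA -!big_split /=.
congr (_ + _); apply: eq_bigr => r _.
  rewrite zextmatD zextmat_sum; congr (_ + _); apply: eq_bigr => l.
  rewrite inE => rl; rewrite zextmat_sum; apply: eq_bigr => L _.
  by rewrite zext_extmat //; have [] := rg_two_layer => _ _ /(_ _ _ rl)[].
by rewrite -mulrzDl zextmatD zextmat_sum.
Qed.

Lemma b_decomposition :
  \sum_(L in large rg) zextvec (b0 b rg st L)
  + \sum_(l in small rg) zextvec (small_b l) *~ count_small rg l = b.
Proof.
pose F L l := zextvec (msg_m st L l).
rewrite -[RHS](count_vec rg_valid) -[RHS]addr0.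
rewrite -[X in _ = _ + X](messages_cancel rg_two_layer F) addrACA -!big_split /=.
congr (_ + _); apply: eq_bigr => r _.
  rewrite zextvecD zextvec_sum; congr (_ + _); apply: eq_bigr => l.
  rewrite inE => rl; rewrite zextvec_sum; apply: eq_bigr => L _.
  by rewrite zext_extvec //; have [] := rg_two_layer => _ _ /(_ _ _ rl)[].
by rewrite -mulrzDl zextvecD zextvec_sum.
Qed.

(** Step 3 subtracts from the inverse of the restricted inverse exactly the terms
which, with the new message itself, make up [small_Lambda]. *)
Lemma small_LambdaE L l : (L, l) \in edges rg ->
  small_Lambda l = invmx (resmat l (invmx (Lambda0 A rg st L))).
Proof.
move=> Ll; have [_ eq_msg] := st_steady Ll.
rewrite /small_Lambda (big_setD1 L) ?inE //= eq_msg /new_Lambda.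
by rewrite subrK addrC subrK.
Qed.

Lemma small_bE L l : (L, l) \in edges rg ->
  small_b l = small_Lambda l *m resvec l (x_of A b rg st L).
Proof.
move=> Ll; have [eq_msg _] := st_steady Ll.
rewrite /small_b (big_setD1 L) ?inE //= eq_msg /new_m (small_LambdaE Ll).
by rewrite subrK addrC subrK.
Qed.

(** Both sides solve the system with matrix [small_Lambda l] and right-hand side
[small_b l], neither of which depends on the parent. *)
Lemma resvec_agree L L' l : (L, l) \in edges rg -> (L', l) \in edges rg ->
  resvec l (x_of A b rg st L) = resvec l (x_of A b rg st L').
Proof.
move=> Ll L'l; have [_ _ sub_edges] := rg_two_layer.
have [lL _ _] := sub_edges _ _ Ll.
have unit_l : small_Lambda l \in unitmx.
  by rewrite (small_LambdaE Ll) unitmx_inv; apply: (st_inv lL).2; rewrite inE.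
apply: (can_inj (mulKmx unit_l)).
by rewrite -(small_bE Ll) -(small_bE L'l).
Qed.

(** The vector y supplies the values at vertices that lie in no large region; it
will be the solution A^-1 b itself. *)
Definition glued (y : 'cV[R]_d) : 'cV[R]_d :=
  \col_v (if [pick L in large rg | v \in L] is Some L
          then zextvec (x_of A b rg st L) v 0 else y v 0).

(** The region picked at a vertex v of L may differ from L.  If v lies in a small
region l, both are parents of l and [resvec_agree] applies; otherwise they are
equal. *)
Lemma glued_large y L : L \in large rg -> subvec L (glued y) = x_of A b rg st L.
Proof.
move=> lL; rewrite -[RHS]sub_zextvec; apply/colP => i.
rewrite [LHS]mxE [RHS]mxE [glued _ _ _]mxE.
set v := enum_val i; have vL : v \in L by apply: enum_valP.
case: pickP => [L' /andP[lL' vL']|/(_ L)]; last by rewrite lL vL.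
have [/existsP[l /andP[sl vl]]|] := boolP [exists l in small rg, v \in l].
  have parent S : S \in large rg -> v \in S -> (S, l) \in edges rg.
    move=> lS vS.
    by have := large_is_parent rg_two_layer rg_valid rg_partition lS sl vS vl;
      rewrite inE.
  have eq_res := resvec_agree (parent _ lL' vL') (parent _ lL vL).
  have := congr1 (fun c : 'cV__ => c (enum_rank_in vl v) 0) eq_res.
  by rewrite !resvecE enum_rankK_in.
rewrite negb_exists => /forallP no_small.
have <- // : L' = L.
apply: (large_unique rg_valid lL' lL vL' vL) => l sl.
by have := no_small l; rewrite sl.
Qed.

(** The decomposition of A applied to the glued vector becomes the decomposition
of b, one region at a time. *)
Lemma glued_solves : A *m glued (invmx A *m b) = b.
Proof.
set y := invmx A *m b; set x := glued y.
rewrite -[in A *m x]Lambda_decomposition -[RHS]b_decomposition.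
rewrite mulmxDl !mulmx_suml; congr (_ + _); apply: eq_bigr.
  move=> L lL; rewrite zextmat_mul glued_large // /x_of mulKVmx //.
  by have [] := st_inv lL.
move=> l sl; rewrite -!scaler_int -scalemxAl; congr (_ *: _).
(* With a parent L, the small system is the one solved by x_L; without parents,
   its rows are those of the system for y, as A has no entries leaving l. *)
have [orphan|[L]] := set_0Vmem (parents rg l); last first.
  rewrite inE => Ll; have [_ _ /(_ _ _ Ll)[lL _ sub]] := rg_two_layer.
  by rewrite zextmat_mul -(resvec_sub _ sub) glued_large // -small_bE.
rewrite /small_Lambda /small_b orphan !big_set0 !addr0.
apply/colP => v; rewrite zext_subvec mxE.
under eq_bigr => u _ do rewrite zext_submat.
case: ifPn => vl /=; last by apply: big1 => u _; rewrite mul0r.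
transitivity ((A *m y) v 0); last by rewrite /y mulKVmx.
rewrite [RHS]mxE; apply: eq_bigr => u _; case: ifPn => ul; last first.
  rewrite (orphan_isolated rg_two_layer rg_valid rg_partition sl orphan vl ul).
  by rewrite !mul0r.
rewrite [x _ _]mxE; case: pickP => // L /andP[lL uL].
have := large_is_parent rg_two_layer rg_valid rg_partition lL sl uL ul.
by rewrite orphan inE.
Qed.

Theorem steady_state_solves L : L \in large rg ->
  x_of A b rg st L = subvec L (invmx A *m b).
Proof.
move=> lL; rewrite -(glued_large (invmx A *m b) lL).
by rewrite -[in RHS]glued_solves mulKmx.
Qed.

End FixedPoint.

(** * In-place sweeps *)
Section Sweeps.
Variables (R : realType) (d : nat) (A : 'M[R]_d) (b : 'cV[R]_d).
Variables (rg : regionGraph d).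
Implicit Types (L l : {set 'I_d}) (st : messages R d).

(** The steady-state hypothesis speaks of the messages on edges, and these are the
ones from which an update computes its results. *)
Definition same_messages st st' : Prop := forall L l, (L, l) \in edges rg ->
  msg_m st L l = msg_m st' L l /\ msg_Lambda st L l = msg_Lambda st' L l.

Lemma same_Lambda0 st st' L : same_messages st st' ->
  Lambda0 A rg st L = Lambda0 A rg st' L.
Proof.
move=> same; congr (_ + _); apply: eq_bigr => l _; apply: eq_bigr => L'.
by rewrite !inE => /andP[_ L'l]; rewrite (same _ _ L'l).2.
Qed.

Lemma same_b0 st st' L : same_messages st st' -> b0 b rg st L = b0 b rg st' L.
Proof.
move=> same; congr (_ + _); apply: eq_bigr => l _; apply: eq_bigr => L'.
by rewrite !inE => /andP[_ L'l]; rewrite (same _ _ L'l).1.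
Qed.

Lemma same_x_of st st' L : same_messages st st' ->
  x_of A b rg st L = x_of A b rg st' L.
Proof. by move=> same; rewrite /x_of (same_Lambda0 _ same) (same_b0 _ same). Qed.

Lemma same_new st st' L l : same_messages st st' ->
  new_m A b rg st L l = new_m A b rg st' L l /\
  new_Lambda A rg st L l = new_Lambda A rg st' L l.
Proof.
move=> same; rewrite /new_m /new_Lambda (same_Lambda0 _ same) (same_x_of _ same).
by split; congr (_ - _); apply: eq_bigr => L'; rewrite !inE => /andP[_ L'l];
  have [] := same _ _ L'l.
Qed.

Lemma foldl_update_notin s st L l : L \notin s ->
  msg_m (foldl (update A b rg) st s) L l = msg_m st L l /\
  msg_Lambda (foldl (update A b rg) st s) L l = msg_Lambda st L l.
Proof.
elim: s st => //= L' s IHs st; rewrite inE negb_or => /andP[/negPf ne_L Ls].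
by have [-> ->] := IHs (update A b rg st L') Ls; rewrite /= ne_L.
Qed.

Variables (order : seq {set 'I_d}) (init : messages R d).
Hypothesis order_uniq : uniq order.

Lemma after_sweep_split n L :
  after_sweep A b rg order init n.+1
  = foldl (update A b rg) (current A b rg order init n L)
      (drop (index L order) order).
Proof. by rewrite /current -foldl_cat cat_take_drop. Qed.

(** L is processed once per sweep, so after the sweep its messages are those
computed at that moment. *)
Lemma after_sweepS n L l : L \in order -> (L, l) \in edges rg ->
  let st := current A b rg order init n L in
  msg_m (after_sweep A b rg order init n.+1) L l = new_m A b rg st L l /\
  msg_Lambda (after_sweep A b rg order init n.+1) L l = new_Lambda A rg st L l.
Proof.
move=> Lo Ll st; rewrite (after_sweep_split n L).
rewrite (drop_nth L) ?index_mem // nth_index //=.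
have notin : L \notin drop (index L order).+1 order.
  move: order_uniq; rewrite -{1}(cat_take_drop (index L order) order).
  by rewrite (drop_nth L) ?index_mem // nth_index // cat_uniq /= => /and4P[].
have [-> ->] := foldl_update_notin (update A b rg st L) l notin.
by rewrite /= eqxx inE Ll.
Qed.

(** The messages of a region processed before L are already those of the end of
the sweep; the others still have their value from its beginning. *)
Lemma current_messages n L L' l :
  let st := current A b rg order init n L in
  let st_old := after_sweep A b rg order init n in
  let st_new := after_sweep A b rg order init n.+1 in
  msg_m st L' l = msg_m st_old L' l /\
    msg_Lambda st L' l = msg_Lambda st_old L' l \/
  msg_m st L' l = msg_m st_new L' l /\
    msg_Lambda st L' l = msg_Lambda st_new L' l.
Proof.
move=> st st_old st_new; set t := take (index L order) order.
have [L't|L't] := boolP (L' \in t); last first.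
  by left; apply: foldl_update_notin.
right; rewrite /st_new (after_sweep_split n L).
have notin : L' \notin drop (index L order) order.
  move: order_uniq; rewrite -{1}(cat_take_drop (index L order) order) cat_uniq.
  by case/and3P => _ /hasPn disj _; apply/negP => /disj /=; rewrite L't.
by have [-> ->] := foldl_update_notin st l notin.
Qed.

End Sweeps.

(** * The theorem *)

Theorem mainTheorem4 (R : realType) (d : nat) (A : 'M[R]_d) (b : 'cV[R]_d)
  (rg : regionGraph d) (order : seq {set 'I_d}) (init : messages R d) (N : nat)
  (A_unit : A \in unitmx)
  (rg_two_layer : is_two_layer A rg)
  (rg_valid : is_valid A rg)
  (rg_partition : is_partitioning rg)
  (order_large : perm_eq order (enum (large rg)))
  (inv_exist : inverses_exist A b rg order init)
  (steady : forall (k : nat) (L l : {set 'I_d}), (L, l) \in edges rg ->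
     msg_m (after_sweep A b rg order init (N + k)) L l
       = msg_m (after_sweep A b rg order init N) L l /\
     msg_Lambda (after_sweep A b rg order init (N + k)) L l
       = msg_Lambda (after_sweep A b rg order init N) L l) :
  forall L : {set 'I_d}, L \in large rg ->
    x_of A b rg (after_sweep A b rg order init N) L
      = subvec L (invmx A *m b) /\
    forall k : nat,
      x_of A b rg (current A b rg order init (N + k) L) L
        = subvec L (invmx A *m b).
Proof.
have order_uniq : uniq order by rewrite (perm_uniq order_large) enum_uniq.
set st := after_sweep A b rg order init N.
have st_current k L : same_messages rg (current A b rg order init (N + k) L) st.
  move=> L' l L'l.
  have [] := current_messages A b rg init order_uniq (N + k) L L' l.
    by have [<- <-] := steady k _ _ L'l.
  by rewrite -addnS; have [<- <-] := steady k.+1 _ _ L'l.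
have st_steady : steady_state A b rg st.
  move=> L l Ll; have [_ _ /(_ _ _ Ll)[lL _ _]] := rg_two_layer.
  have Lo : L \in order by rewrite (perm_mem order_large) mem_enum.
  have := st_current 0 L; rewrite addn0 => same.
  have [<- <-] := same_new A b L l same.
  have [<- <-] := after_sweepS A b init order_uniq N Lo Ll.
  by have := steady 1 _ _ Ll; rewrite addn1 => -[-> ->].
have st_inv : invertible_state A rg st.
  move=> L lL; have := inv_exist N L lL.
  by have := same_Lambda0 A L (st_current 0 L); rewrite addn0 => ->.
have solved L : L \in large rg -> x_of A b rg st L = subvec L (invmx A *m b).
  exact: steady_state_solves.
move=> L lL; split; first exact: solved.
by move=> k; rewrite (same_x_of A b L (st_current k L)) solved.
Qed.
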